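(* There exists a constant $K>0$ with the following property: for every finite-dimensional complex Hilbert space $H$, every $n\geqslant 1$, and every bounded linear map $\Phi:\ell^\infty_n\to B(H)$ such that $\Phi(e_k)$ is a rank one operator for every $1\leqslant k\leqslant n$, one has $\|\Phi\|_{cb}\leqslant K\|\Phi\|$. (The constant $K$ does not depend on $H$, $n$, or $\Phi$.)
   Context: $B(H)$ is the algebra of bounded operators on $H$ with the operator norm. $\ell^\infty_n$ is $\mathbb{C}^n$ with the maximum norm, regarded as a $C^*$-algebra by identifying it with the algebra of diagonal operators on the Hilbert space $\mathbb{C}^n$; $\{e_k\}_{k=1}^n$ is its unit vector basis. $\|\Phi\|$ is the operator norm of $\Phi$ from $\ell^\infty_n$ to $B(H)$. For a $C^*$-algebra $\mathcal{A}\subset B(H_0)$ ($H_0$ a Hilbert space), $\mathcal{M}_m(\mathcal{A})$ denotes the space of $m\times m$ matrices with entries in $\mathcal{A}$, identified with a space of operators on $H_0^m=H_0\oplus\cdots\oplus H_0$ ($m$ times, Hilbert space direct sum) and equipped with the operator norm. For a bounded linear map $\Psi:\mathcal{A}\to\mathcal{B}$ between $C^*$-algebras and $m\geqslant 1$, the map $\Psi_{(m)}:\mathcal{M}_m(\mathcal{A})\to\mathcal{M}_m(\mathcal{B})$ acts entrywise: $\Psi_{(m)}((a_{i,j})_{i,j=1}^m)=(\Psi(a_{i,j}))_{i,j=1}^m$. The map $\Psi$ is completely bounded if the maps $\Psi_{(m)}$ are uniformly bounded in $m$, and then $\|\Psi\|_{cb}=\sup_{m\geqslant 1}\|\Psi_{(m)}\|$.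 *)

(* Defs.v *)
From HB Require Import structures.
From mathcomp Require Import all_boot all_order all_algebra.
From mathcomp Require Import spectral.
From mathcomp Require Import all_classical all_reals ereal.
From mathcomp Require Import topology normedtype.
From mathcomp Require Import complex.

Set Implicit Arguments.
Unset Strict Implicit.
Unset Printing Implicit Defensive.

Import Order.TTheory GRing.Theory Num.Theory Num.Def.
Import numFieldNormedType.Exports.

Local Open Scope classical_set_scope.
Local Open Scope ring_scope.

(* A finite-dimensional complex Hilbert space is a [vectType] over [R[i]] with
   a positive definite Hermitian form (linear in its first argument); on it
   every linear operator is bounded, so B(H) is ['End(H)].
   All norms take values in [\bar R], so that no junk value is needed for the
   supremum of an unbounded set. *)

Definition opnorm (R : realType) (U V : Type)
    (normU : U -> \bar R) (normV : V -> \bar R) (f : U -> V) : \bar R :=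
  ereal_sup [set normV (f u) | u in [set u | (normU u <= 1)%E]].

Section Hilbert.
Variables (R : realType) (H : vectType R[i]) (form : {dot H for conjC}).

(* [form u u] is a nonnegative element of [R[i]], hence real. *)
Definition hilbert_norm (u : H) : R := Num.sqrt (complex.Re (form u u)).

(* Norm of the Hilbert space direct sum of [m] copies of [H]. *)
Definition hilbert_sum_norm (m : nat) (u : {ffun 'I_m -> H}) : \bar R :=
  (Num.sqrt (\sum_(i < m) hilbert_norm (u i) ^+ 2))%:E.

Definition mxop (m : nat) (A : 'M['End(H)]_m) (u : {ffun 'I_m -> H}) :
    {ffun 'I_m -> H} :=
  [ffun i => \sum_(j < m) A i j (u j)].

Definition BH_norm (T : 'End(H)) : \bar R :=
  opnorm (fun u => (hilbert_norm u)%:E) (fun u => (hilbert_norm u)%:E) T.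

Definition BH_mxnorm (m : nat) (A : 'M['End(H)]_m) : \bar R :=
  opnorm (@hilbert_sum_norm m) (@hilbert_sum_norm m) (mxop A).

End Hilbert.

Section Linf.
Variables (R : realType) (n : nat).

(* The library norm on ['rV[R[i]]_n] is the maximum norm; it takes its values
   in the nonnegative reals of [R[i]]. *)
Definition linf_norm (a : 'rV[R[i]]_n) : \bar R := (complex.Re `|a|)%:E.

Definition diag_op (a : 'rV[R[i]]_n) : 'End('rV[R[i]]_n) :=
  linfun (mulmxr (diag_mx a)).

Definition linf_mxnorm (m : nat) (A : 'M['rV[R[i]]_n]_m) : \bar R :=
  BH_mxnorm (@dotmx R[i] n) (map_mx diag_op A).

End Linf.

(* [normA] and [normB] are the norms of the matrices over [A] and [B]. *)
Definition cbnorm (R : realType) (A B : Type)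
    (normA : forall m, 'M[A]_m -> \bar R) (normB : forall m, 'M[B]_m -> \bar R)
    (Psi : A -> B) : \bar R :=
  ereal_sup [set opnorm (@normA m) (@normB m) (map_mx Psi) |
             m in [set m : nat | (0 < m)%N]].

Definition rank_one (F : fieldType) (V : vectType F) (T : 'End(V)) : Prop :=
  \dim (limg T) = 1%N.

(* Main.v *)
Require Import Defs.
From mathcomp Require Import all_boot all_order all_algebra.
From mathcomp Require Import spectral.
From mathcomp Require Import all_classical all_reals ereal.
From mathcomp Require Import topology normedtype.
From mathcomp Require Import complex.
From mathcomp Require Import ring lra.

Set Implicit Arguments.
Unset Strict Implicit.
Unset Printing Implicit Defensive.

Import Order.TTheory GRing.Theory Num.Theory Num.Def.
Import numFieldNormedType.Exports.

Local Open Scope ring_scope.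

(* Write Phi(e_k) = f_k(.) x_k. Choosing phases a_k and testing Phi(a) gives
   sum_k |f_k(u)| |<x_k, v>| <= |Phi| |u| |v|. Replacing u and v by independent
   random signed sums of vectors u_j and v_i, Khintchine's L^1 inequality turns
   this into
     sum_k (sum_j |f_k(u_j)|^2)^(1/2) (sum_i |<x_k, v_i>|^2)^(1/2)
       <= 4 |Phi| (sum_j |u_j|^2)^(1/2) (sum_i |v_i|^2)^(1/2),
   which bounds the cb-norm because a matrix of norm at most one over linf is a
   family (A_k) of contractions of C^m, and the k-th term of the pairing of its
   image with u and v is <A_k (f_k(u_j))_j, (<v_i, x_k>)_i>. *)

(** * Averages over independent random signs *)

Section Rademacher.
Variable R : realFieldType.

(* The mean of [F] at the random sum of the vectors of [s] with independent
   uniform signs. *)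
Fixpoint rademacher (V : zmodType) (s : seq V) (F : V -> R) : R :=
  if s is v :: s' then rademacher s' (fun w => (F (w + v) + F (w - v)) / 2)
  else F 0.

Variable V : zmodType.
Implicit Types (s : seq V) (F G : V -> R).

Lemma eq_rademacher s F G : F =1 G -> rademacher s F = rademacher s G.
Proof.
by elim: s F G => [|v s IHs] F G FG /=; [|apply: IHs => w]; rewrite !FG.
Qed.

Lemma ler_rademacher s F G :
  (forall w, F w <= G w) -> rademacher s F <= rademacher s G.
Proof.
elim: s F G => [|v s IHs] F G FG //=; apply: IHs => w.
by rewrite ler_pM2r ?invr_gt0 ?ltr0n// lerD.
Qed.

Lemma rademacher_cst s (a : R) : rademacher s (fun=> a) = a.
Proof.
by elim: s => //= v s IHs; rewrite -[RHS]IHs; apply: eq_rademacher => w; field.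
Qed.

Lemma rademacherD s F G :
  rademacher s (fun w => F w + G w) = rademacher s F + rademacher s G.
Proof.
elim: s F G => //= v s IHs F G; rewrite -IHs.
by apply: eq_rademacher => w; field.
Qed.

Lemma rademacherZ s (a : R) F :
  rademacher s (fun w => a * F w) = a * rademacher s F.
Proof.
elim: s F => //= v s IHs F; rewrite -IHs.
by apply: eq_rademacher => w; field.
Qed.

Lemma rademacher_ge0 s F : (forall w, 0 <= F w) -> 0 <= rademacher s F.
Proof. by move=> F0; rewrite -[0](rademacher_cst s) ler_rademacher. Qed.

(** The variance of [F], expanded around its mean [mu], is nonnegative. *)
Lemma rademacher_sqr_le s F :
  rademacher s F ^+ 2 <= rademacher s (fun w => F w ^+ 2).
Proof.
set mu := rademacher s F.
have : 0 <= rademacher s (fun w => (F w - mu) ^+ 2).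
  by apply: rademacher_ge0 => w; exact: sqr_ge0.
rewrite (@eq_rademacher _ _
  (fun w => F w ^+ 2 + (- 2 * mu * F w + mu ^+ 2))); last by move=> w; ring.
rewrite !rademacherD rademacherZ rademacher_cst -/mu; lra.
Qed.

End Rademacher.

(** Transfers signed sums of vectors to signed sums of their values under an additive functional,
    where the scalar Khintchine inequality is available. *)
Lemma rademacher_map (R : realFieldType) (V W : zmodType) (f : W -> V)
    (t : seq W) (F : V -> R) :
  {morph f : x y / x - y} ->
  rademacher (map f t) F = rademacher t (fun w => F (f w)).
Proof.
move=> fB; have f0 : f 0 = 0 by rewrite -[X in f X](subrr 0) fB subrr.
have fD x y : f (x + y) = f x + f y.
  by rewrite -[y in LHS]opprK -[- y]sub0r fB fB f0 sub0r opprK.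
elim: t F => [|v t IHt] F /=; first by rewrite f0.
by rewrite IHt; apply: eq_rademacher => w; rewrite fB fD.
Qed.

Lemma exchange_rademacher (R : realFieldType) (I : finType) (V : zmodType)
    (s : seq V) (F : I -> V -> R) :
  rademacher s (fun w => \sum_i F i w) = \sum_i rademacher s (F i).
Proof.
elim: s F => //= v s IHs F; rewrite -IHs; apply: eq_rademacher => w.
by rewrite -big_split/= mulr_suml.
Qed.

(** * The complex modulus and Khintchine's inequality for complex coefficients *)

Section Modulus.
Variable R : realType.
Implicit Types (z w : R[i]) (s : seq R[i]).

Definition cabs z : R := complex.Re `|z|.

Lemma cabsE z : (cabs z)%:C%C = `|z|.
Proof. by rewrite /cabs RRe_real ?normr_real. Qed.

Lemma cabs_ge0 z : 0 <= cabs z.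
Proof. by rewrite -lecR cabsE normr_ge0. Qed.

Lemma cabsM z w : cabs (z * w) = cabs z * cabs w.
Proof. by apply: complexI; rewrite rmorphM/= !cabsE normrM. Qed.

Lemma cabsJ z : cabs z^* = cabs z.
Proof. by apply: complexI; rewrite !cabsE norm_conjC. Qed.

Lemma ler_cabs_sum (I : finType) (F : I -> R[i]) :
  cabs (\sum_i F i) <= \sum_i cabs (F i).
Proof.
rewrite -lecR cabsE rmorph_sum/=; under [leRHS]eq_bigr do rewrite cabsE.
exact: ler_norm_sum.
Qed.

Lemma sqr_cabs z : cabs z ^+ 2 = complex.Re z ^+ 2 + complex.Im z ^+ 2.
Proof. by apply: complexI; rewrite add_Re2_Im2 rmorphXn/= cabsE. Qed.

(** Averaging over the sign of [c] cancels the cross term: the mean of |w + c|^2 and |w - c|^2 is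
    |w|^2 + |c|^2. *)
Lemma rademacher_sqr_cabs s :
  rademacher s (fun z => cabs z ^+ 2) = \sum_(c <- s) cabs c ^+ 2.
Proof.
elim: s => [|c s IHs] /=; first by rewrite big_nil /cabs normr0/= expr0n.
rewrite big_cons -IHs addrC -[X in _ + X](rademacher_cst s) -rademacherD.
apply: eq_rademacher => w; rewrite !sqr_cabs; case: w c => [a b] [p q] /=.
by field.
Qed.

Lemma rademacher_cabs4_le s :
  rademacher s (fun z => cabs z ^+ 4) <= 3 * (\sum_(c <- s) cabs c ^+ 2) ^+ 2.
Proof.
elim: s => [|c s IHs] /=.
  by rewrite big_nil /cabs normr0/= !expr0n/= mulr0.
rewrite big_cons; set S := \sum_(_ <- _) _ in IHs *.
apply: (@le_trans _ _ (rademacher s (fun w =>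
    cabs w ^+ 4 + (6 * cabs c ^+ 2 * cabs w ^+ 2 + cabs c ^+ 4)))).
  apply: ler_rademacher => w.
  rewrite !(exprM _ 2 2) !sqr_cabs; case: w c => [a b] [p q] /=.
  have := sqr_ge0 (a * q - b * p); nra.
rewrite !rademacherD rademacherZ rademacher_cst rademacher_sqr_cabs -/S.
have := sqr_ge0 (cabs c ^+ 2); rewrite -exprM; nra.
Qed.

Lemma khintchine s :
  Num.sqrt (\sum_(c <- s) cabs c ^+ 2) <= 2 * rademacher s cabs.
Proof.
set S := \sum_(_ <- _) _; set t := Num.sqrt S.
have S0 : 0 <= S by apply: sumr_ge0 => c _; exact: sqr_ge0.
have t0 : 0 <= t := sqrtr_ge0 _.
have tS : t ^+ 2 = S by rewrite sqr_sqrtr.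
have E0 : 0 <= rademacher s cabs by apply: rademacher_ge0; exact: cabs_ge0.
(* [x (x - 2t)^2 (x + 4t) >= 0] bounds the first moment from below by the
   second and the fourth. *)
have : 12 * t ^+ 2 * S <= 16 * t ^+ 3 * rademacher s cabs + 3 * S ^+ 2.
  apply: le_trans (lerD (lexx _) (rademacher_cabs4_le s)).
  rewrite -[S](rademacher_sqr_cabs s) -!rademacherZ -rademacherD.
  apply: ler_rademacher => z; have x0 := cabs_ge0 z.
  have : 0 <= cabs z * (cabs z - 2 * t) ^+ 2 * (cabs z + 4 * t).
    by apply: mulr_ge0; [rewrite mulr_ge0 ?sqr_ge0|lra].
  nra.
have [->|tn0] := eqVneq t 0; first by rewrite mulr_ge0.
have t3 : 0 < t ^+ 3 by rewrite exprn_gt0// lt_def tn0.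
(* With S = t^2 the inequality reads 9 t^4 <= 16 t^3 E, where E is the first moment; hence t <=
   (16/9) E <= 2 E. *)
rewrite -tS => h; rewrite -(ler_pM2l t3); have := exprn_ge0 4 t0; nra.
Qed.

End Modulus.

(** * Hilbert norms and the moments of random signed sums of vectors *)

Section HilbertNorm.
Variables (R : realType) (H : vectType R[i]) (form : {dot H for conjC}).
Implicit Types u v x : H.

Lemma hilbert_norm_ge0 u : 0 <= hilbert_norm form u.
Proof. exact: sqrtr_ge0. Qed.

Lemma sqr_hilbert_norm u : (hilbert_norm form u ^+ 2)%:C%C = form u u.
Proof.
have f0 := dnorm_ge0 form u; have fR : complex.Re (form u u) \is Num.nneg.
  by rewrite nnegrE -lecR RRe_real ?ger0_real.
by rewrite sqr_sqrtr// RRe_real ?ger0_real.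
Qed.

Lemma sqr_hilbert_normE u : hilbert_norm form u ^+ 2 = complex.Re (form u u).
Proof. by rewrite -sqr_hilbert_norm. Qed.

Lemma hilbert_normZ a u :
  hilbert_norm form (a *: u) = cabs a * hilbert_norm form u.
Proof.
apply/eqP; rewrite -(@eqrXn2 _ 2)// ?mulr_ge0 ?hilbert_norm_ge0 ?cabs_ge0//.
apply/eqP/complexI; rewrite exprMn [RHS]rmorphM/= !sqr_hilbert_norm.
by rewrite rmorphXn/= cabsE dnormZ.
Qed.

Lemma cabs_form_le u v :
  cabs (form u v) <= hilbert_norm form u * hilbert_norm form v.
Proof.
rewrite -(@ler_pXn2r _ 2)// ?nnegrE ?mulr_ge0 ?hilbert_norm_ge0 ?cabs_ge0//.
rewrite -lecR exprMn [leRHS]rmorphM/= !sqr_hilbert_norm rmorphXn/= cabsE.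
exact: CauchySchwarz.
Qed.

Lemma cabs_formC u v : cabs (form u v) = cabs (form v u).
Proof. by rewrite hermC/= expr0 mul1r cabsJ. Qed.

Lemma hilbert_parallelogram u v :
  hilbert_norm form (u + v) ^+ 2 + hilbert_norm form (u - v) ^+ 2 =
  2 * (hilbert_norm form u ^+ 2 + hilbert_norm form v ^+ 2).
Proof.
apply: complexI; rewrite [RHS]rmorphM !rmorphD/= !sqr_hilbert_norm dnormD dnormB.
by ring.
Qed.

(** The parallelogram law removes the cross terms one sign at a time. *)
Lemma rademacher_sqr_hilbert_norm (s : seq H) :
  rademacher s (fun u => hilbert_norm form u ^+ 2) =
  \sum_(v <- s) hilbert_norm form v ^+ 2.
Proof.
elim: s => [|v s IHs] /=.
  by rewrite big_nil sqr_hilbert_normE linear0l.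
rewrite big_cons -IHs addrC -[X in _ + X](rademacher_cst s) -rademacherD.
by apply: eq_rademacher => w; rewrite hilbert_parallelogram; field.
Qed.

Lemma rademacher_hilbert_norm_le (s : seq H) :
  rademacher s (hilbert_norm form) <=
  Num.sqrt (\sum_(v <- s) hilbert_norm form v ^+ 2).
Proof.
rewrite -rademacher_sqr_hilbert_norm.
apply: le_trans (ler_wsqrtr (rademacher_sqr_le s (hilbert_norm form))).
by rewrite sqrtr_sqr ler_norm.
Qed.

End HilbertNorm.

(** * The Euclidean norm on rows *)

Definition row_norm (R : realType) n (u : 'rV[R[i]]_n) : R :=
  hilbert_norm (@dotmx R[i] n) u.

Section RowNorm.
Variables (R : realType) (n : nat).
Implicit Types u v : 'rV[R[i]]_n.

Lemma row_norm_ge0 u : 0 <= row_norm u.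
Proof. exact: hilbert_norm_ge0. Qed.

Lemma row_normZ a u : row_norm (a *: u) = cabs a * row_norm u.
Proof. exact: hilbert_normZ. Qed.

Lemma cabs_dotmx_le u v : cabs (dotmx u v) <= row_norm u * row_norm v.
Proof. exact: cabs_form_le. Qed.

Lemma sqr_row_norm u : row_norm u ^+ 2 = \sum_(k < n) cabs (u 0 k) ^+ 2.
Proof.
apply: complexI; rewrite sqr_hilbert_norm/= dotmxE mxE rmorph_sum/=.
by apply: eq_bigr => k _; rewrite !mxE -normCK rmorphXn/= cabsE.
Qed.

Lemma row_normE u : row_norm u = Num.sqrt (\sum_(k < n) cabs (u 0 k) ^+ 2).
Proof. by rewrite -sqr_row_norm sqrtr_sqr ger0_norm ?row_norm_ge0. Qed.

End RowNorm.

(** * Bounds extracted from operator norms, rank one factorization, and coordinate slices over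
    linf *)

Lemma opnorm_bound (R : realType) (U V : lmodType R[i]) (p : U -> R) (q : V -> R)
    (f : U -> V) (N : R) :
  (forall a u, p (a *: u) = cabs a * p u) ->
  (forall a v, q (a *: v) = cabs a * q v) ->
  (forall a u, f (a *: u) = a *: f u) ->
  (forall u, 0 <= p u) ->
  (opnorm (fun u => (p u)%:E) (fun v => (q v)%:E) f <= N%:E)%E ->
  forall u, q (f u) <= N * p u.
Proof.
move=> pZ qZ fZ p0 fN u.
have qfN (t : R) : 0 <= t -> t * p u <= 1 -> t * q (f u) <= N.
  move=> t0 tu; have ct : cabs t%:C%C = t.
    by apply: complexI; rewrite cabsE ger0_norm// ler0c.
  rewrite -[X in X * q _]ct -qZ -fZ -lee_fin; apply: le_trans fN.
  apply: ereal_sup_ubound; exists (t%:C%C *: u) => //=.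
  by rewrite pZ ct lee_fin.
have [u0|] := eqVneq (p u) 0.
  rewrite u0 mulr0 leNgt; apply/negP => q_gt0.
  (* When [p u = 0] every multiple of [u] lies in the unit ball; this one would have an image of
     size [|N| + 1], which exceeds [N]. *)
  have := qfN ((`|N| + 1) / q (f u)).
  rewrite u0 mulr0 ler01 divfK ?gt_eqF// => /(_ _ isT).
  rewrite divr_ge0 ?addr_ge0// ?(ltW q_gt0)// => /(_ isT).
  by rewrite leNgt ltr_pwDr// ler_norm.
move=> u_neq0; have u_gt0 : 0 < p u by rewrite lt_def u_neq0 p0.
by rewrite -ler_pdivrMr// mulrC qfN ?invr_ge0// mulVf.
Qed.

(** [x] spans the range, and [f] is the coordinate of [T u] along [x]. *)
Lemma rank_oneP (F : fieldType) (V : vectType F) (T : 'End(V)) :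
  rank_one T -> exists (x : V) (f : V -> F),
    {morph f : u v / u - v} /\ forall u, T u = f u *: x.
Proof.
move=> T1; have [x defx] : exists x, limg T = <[x]>%VS.
  have := vbasisP (limg T); move: (vbasis _); rewrite T1 => X /span_basis <-.
  by exists X`_0; case/tupleP: X => x X; rewrite tuple0 span_seq1.
have x0 : x != 0.
  by apply: contra_eq_neq T1 => x0; rewrite defx x0 dimv0.
exists x, (fun u => coord [tuple x] 0 (T u)); split=> [u v|u].
  by rewrite !linearB.
have: T u \in <<[tuple x]>>%VS by rewrite span_seq1 -defx memv_img ?memvf.
by move/coord_span; rewrite big_ord1.
Qed.

Lemma linf_norm_le1 (R : realType) n (a : 'rV[R[i]]_n) :
  (forall k, cabs (a 0 k) <= 1) -> (linf_norm a <= 1)%E.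
Proof.
move=> a1; rewrite lee_fin -lecR RRe_real ?normr_real//.
rewrite -[`|a|]/(mx_norm a); have [->|] := eqVneq (mx_norm a) 0.
  exact: ler01.
by move=> /mx_norm_neq0[[i k] ->]; rewrite ord1 -cabsE lecR.
Qed.

(** The conjugate phase; it is 0 at [z = 0], so its modulus is only bounded by 1. *)
Definition phase (R : realType) (z : R[i]) : R[i] := z^* / `|z|.

Lemma phaseM (R : realType) (z : R[i]) : phase z * z = (cabs z)%:C%C.
Proof.
rewrite cabsE /phase; have [->|z0] := eqVneq z 0; first by rewrite mulr0 normr0.
by rewrite mulrAC mulrC [_^* * _]mulrC -normCK expr2 mulKf ?normr_eq0.
Qed.

Lemma cabs_phase_le1 (R : realType) (z : R[i]) : cabs (phase z) <= 1.
Proof.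
rewrite -lecR cabsE /phase; have [->|z0] := eqVneq z 0.
  by rewrite rmorph0 mul0r normr0 ler01.
by rewrite normrM normfV normr_id norm_conjC divff// normr_eq0.
Qed.

(** Diagonal operators preserve the line of [e = delta_mx 0 k]. The vectors with components
    [p 0 j *: e] form an isometric copy of C^m, on which [A] acts as its k-th scalar slice. *)
Lemma linf_mxnorm_le1 (R : realType) n m (A : 'M['rV[R[i]]_n]_m)
    (p : 'rV[R[i]]_m) (k : 'I_n) :
  (linf_mxnorm A <= 1)%E ->
  row_norm (\row_i \sum_j A i j 0 k * p 0 j) <= row_norm p.
Proof.
move=> A1; pose e : 'rV[R[i]]_n := delta_mx 0 k.
pose hsn (u : {ffun 'I_m -> 'rV[R[i]]_n}) : R :=
  Num.sqrt (\sum_i row_norm (u i) ^+ 2).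
have hsnZ a u : hsn (a *: u) = cabs a * hsn u.
  rewrite -[cabs a]ger0_norm ?cabs_ge0// -sqrtr_sqr -sqrtrM ?sqr_ge0//.
  congr Num.sqrt; rewrite mulr_sumr; apply: eq_bigr => i _.
  by rewrite -exprMn -row_normZ; congr (row_norm _ ^+ 2); rewrite ffunE.
have e1 : row_norm e = 1.
  rewrite row_normE (bigD1 k)//= big1 => [|l lk].
    by rewrite mxE !eqxx /cabs normr1/= expr1n addr0 sqrtr1.
  by rewrite mxE (negPf lk) andbF /cabs normr0/= expr0n.
have hsn_e (c : 'I_m -> R[i]) :
    hsn [ffun i => c i *: e] = row_norm (\row_i c i).
  rewrite row_normE; congr Num.sqrt; apply: eq_bigr => i _.
  by rewrite ffunE row_normZ e1 mulr1 mxE.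
have mxopZ a u : mxop (map_mx (@diag_op R n) A) (a *: u) =
    a *: mxop (map_mx (@diag_op R n) A) u.
  apply/ffunP => i; rewrite !ffunE scaler_sumr; apply: eq_bigr => j _.
  by rewrite ffunE linearZ.
have := opnorm_bound hsnZ hsnZ mxopZ (fun=> sqrtr_ge0 _) A1
  [ffun j => p 0 j *: e].
rewrite mul1r hsn_e.
have -> : \row_j p 0 j = p by apply/rowP => j; rewrite mxE.
apply: le_trans; rewrite -hsn_e.
rewrite le_eqVlt; apply/orP; left; apply/eqP; congr hsn; apply/ffunP => i.
rewrite !ffunE scaler_suml; apply: eq_bigr => j _.
rewrite ffunE mxE lfunE/= -scalemxAl -rowE mulrC -scalerA; congr (_ *: _).
by apply/rowP => l; rewrite !mxE eqxx/= mulr_natr eq_sym.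
Qed.

(** * Linear maps sending each basis vector of linf to [f k (.) *: x k] *)

Section RankOneImages.
Variables (R : realType) (H : vectType R[i]) (form : {dot H for conjC}) (n : nat).
Variables (Phi : {linear 'rV[R[i]]_n -> 'End(H)}) (N : R).
Variables (x : 'I_n -> H) (f : 'I_n -> H -> R[i]).
Hypothesis fB : forall k, {morph f k : u v / u - v}.
Hypothesis PhiE : forall k u, Phi (delta_mx 0 k) u = f k u *: x k.
Hypothesis Phi_le : forall a u, (linf_norm a <= 1)%E ->
  hilbert_norm form (Phi a u) <= N * hilbert_norm form u.

Lemma linf_map_apply a u : Phi a u = \sum_k (a 0 k * f k u) *: x k.
Proof.
rewrite {1}(row_sum_delta a) linear_sum sum_lfunE; apply: eq_bigr => k _.
by rewrite linearZ scale_lfunE PhiE scalerA.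
Qed.

Lemma sum_cabs_coeff_le u v :
  \sum_k cabs (f k u) * cabs (form (x k) v) <=
  N * hilbert_norm form u * hilbert_norm form v.
Proof.
(* These phases make every term of [form (Phi a u) v] a nonnegative real. *)
pose a := \row_k phase (f k u * form (x k) v).
have a1 : (linf_norm a <= 1)%E.
  by apply: linf_norm_le1 => k; rewrite mxE cabs_phase_le1.
apply: le_trans (ler_wpM2r (hilbert_norm_ge0 form v) (Phi_le u a1)).
apply: le_trans (cabs_form_le form _ v).
have -> : form (Phi a u) v = (\sum_k cabs (f k u) * cabs (form (x k) v))%:C%C.
  rewrite linf_map_apply linear_sumlz rmorph_sum/=; apply: eq_bigr => k _.
  by rewrite linearZl_LR/= mxE -mulrA phaseM cabsM.
rewrite -lecR cabsE ger0_norm// ler0c sumr_ge0// => k _.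
by rewrite mulr_ge0 ?cabs_ge0.
Qed.

(** Khintchine is used once for the [u j] and once for the [v i], whence 4 = 2 * 2. Under the double
    mean, [sum_cabs_coeff_le] applies to each pair of signed sums. *)
Lemma sum_square_function_le m (u v : 'I_m -> H) : 0 <= N ->
  \sum_k Num.sqrt (\sum_j cabs (f k (u j)) ^+ 2) *
         Num.sqrt (\sum_i cabs (form (v i) (x k)) ^+ 2) <=
  4 * N * Num.sqrt (\sum_j hilbert_norm form (u j) ^+ 2) *
          Num.sqrt (\sum_i hilbert_norm form (v i) ^+ 2).
Proof.
move=> N0; have khintchine_of (w : 'I_m -> H) (g : H -> R[i]) :
    {morph g : y z / y - z} ->
    Num.sqrt (\sum_j cabs (g (w j)) ^+ 2) <=
    2 * rademacher (map w (index_enum 'I_m)) (fun z => cabs (g z)).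
  move=> gB; rewrite -(rademacher_map _ _ gB).
  by apply: le_trans (khintchine _); rewrite !big_map.
have mean_norm (w : 'I_m -> H) :
    rademacher (map w (index_enum 'I_m)) (hilbert_norm form) <=
    Num.sqrt (\sum_j hilbert_norm form (w j) ^+ 2).
  by apply: le_trans (rademacher_hilbert_norm_le _ _) _; rewrite big_map.
set su := map u (index_enum 'I_m); set sv := map v (index_enum 'I_m).
have mean_ge0 (s : seq H) : 0 <= rademacher s (hilbert_norm form).
  by apply: rademacher_ge0; exact: hilbert_norm_ge0.
apply: (@le_trans _ _ (\sum_k (2 * rademacher su (fun y => cabs (f k y))) *
    (2 * rademacher sv (fun z => cabs (form z (x k)))))).
  apply: ler_sum => k _; apply: ler_pM; rewrite ?sqrtr_ge0 ?khintchine_of//.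
  by move=> y z; rewrite linearBl.
apply: (@le_trans _ _ (4 * rademacher su (fun y => rademacher sv (fun z =>
    \sum_k cabs (f k y) * cabs (form (x k) z))))).
  under [X in _ <= 4 * X]eq_rademacher => y.
    rewrite exchange_rademacher; under eq_bigr do rewrite rademacherZ.
    over.
  rewrite exchange_rademacher mulr_sumr; apply: ler_sum => k _.
  under [X in _ <= 4 * X]eq_rademacher => y do rewrite mulrC.
  rewrite rademacherZ.
  under [X in 2 * _ * (2 * X)]eq_rademacher => z do rewrite cabs_formC.
  by rewrite le_eqVlt; apply/orP; left; apply/eqP; ring.
rewrite -!mulrA ler_pM2l//.
apply: (@le_trans _ _ (N * (rademacher su (hilbert_norm form) *
    rademacher sv (hilbert_norm form)))).
  set Eu := rademacher su (hilbert_norm form).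
  set Ev := rademacher sv (hilbert_norm form).
  (* By independence, the double mean of a product is the product of the means. *)
  have -> : N * (Eu * Ev) = rademacher su (fun y => rademacher sv (fun z =>
      N * hilbert_norm form y * hilbert_norm form z)).
    transitivity (rademacher su (fun y => N * Ev * hilbert_norm form y)).
      by rewrite rademacherZ -/Eu; ring.
    by apply: eq_rademacher => y; rewrite rademacherZ -/Ev; ring.
  apply: ler_rademacher => y; apply: ler_rademacher => z.
  exact: sum_cabs_coeff_le.
by rewrite ler_wpM2l ?ler_pM ?mean_norm.
Qed.

(** The image [w] is paired with itself: this gives W^2 <= 4 N U W, and dividing by W leaves the
    claim. *)
Lemma mxop_bound m (A : 'M['rV[R[i]]_n]_m) (u : {ffun 'I_m -> H}) :
  (linf_mxnorm A <= 1)%E -> 0 <= N ->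
  (hilbert_sum_norm form (mxop (map_mx Phi A) u) <=
   (4 * N)%:E * hilbert_sum_norm form u)%E.
Proof.
move=> A1 N0; set w := mxop _ u; rewrite -EFinM lee_fin.
set W := Num.sqrt _; set U := Num.sqrt _.
pose p k : 'rV[R[i]]_m := \row_j f k (u j).
pose q k : 'rV[R[i]]_m := \row_i form (w i) (x k).
pose Ap k : 'rV[R[i]]_m := \row_i \sum_j A i j 0 k * p k 0 j.
have wE i : w i = \sum_k Ap k 0 i *: x k.
  rewrite ffunE; under eq_bigr do rewrite mxE linf_map_apply.
  rewrite exchange_big; apply: eq_bigr => k _; rewrite mxE scaler_suml.
  by apply: eq_bigr => j _; rewrite mxE.
have sumE : (\sum_i hilbert_norm form (w i) ^+ 2)%:C%C =
    \sum_k dotmx (Ap k) (q k).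
  rewrite rmorph_sum/= (eq_bigr (fun i => \sum_k Ap k 0 i * (q k 0 i)^*)).
    by rewrite exchange_big; apply: eq_bigr => k _; rewrite dotmxE mxE;
      apply: eq_bigr => i _; rewrite !mxE.
  move=> i _; rewrite sqr_hilbert_norm {1}wE linear_sumlz; apply: eq_bigr => k _.
  by rewrite linearZl_LR/= !mxE hermC/= expr0 mul1r.
have w_le : \sum_i hilbert_norm form (w i) ^+ 2 <=
    \sum_k row_norm (p k) * row_norm (q k).
  (* The complex sum equals its own modulus, being a nonnegative real, so the triangle inequality
     applies over [k]. *)
  rewrite -lecR sumE -[X in X <= _]ger0_norm; last first.
    by rewrite -sumE ler0c sumr_ge0// => i _; exact: sqr_ge0.
  rewrite -cabsE lecR; apply: le_trans (ler_cabs_sum _) _.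
  apply: ler_sum => k _; apply: le_trans (cabs_dotmx_le _ _) _.
  exact: ler_wpM2r (row_norm_ge0 _) _ _ (linf_mxnorm_le1 (p k) k A1).
have := le_trans w_le (_ : _ <= 4 * N * U * W).
have WE : W ^+ 2 = \sum_i hilbert_norm form (w i) ^+ 2.
  by rewrite sqr_sqrtr// sumr_ge0// => i _; exact: sqr_ge0.
have [->|W0] := eqVneq W 0; first by rewrite !mulr_ge0 ?sqrtr_ge0.
rewrite -WE expr2 ler_pM2r ?lt_def ?W0 ?sqrtr_ge0//; apply.
apply: le_trans (sum_square_function_le u w N0); apply: ler_sum => k _.
rewrite !row_normE.
have -> : \sum_j cabs (p k 0 j) ^+ 2 = \sum_j cabs (f k (u j)) ^+ 2.
  by apply: eq_bigr => j _; rewrite mxE.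
rewrite le_eqVlt; apply/orP; left; apply/eqP; congr (_ * Num.sqrt _).
by apply: eq_bigr => i _; rewrite mxE.
Qed.

End RankOneImages.

Theorem theorem2p3 (R : realType) :
  exists K : R, 0 < K /\
    forall (H : vectType R[i]) (form : {dot H for conjC}) (n : nat)
           (Phi : {linear 'rV[R[i]]_n -> 'End(H)}),
      (1 <= n)%N ->
      (opnorm (@linf_norm R n) (BH_norm form) Phi < +oo)%E ->
      (forall k : 'I_n, rank_one (Phi (delta_mx 0 k))) ->
      (cbnorm (@linf_mxnorm R n) (@BH_mxnorm R H form) Phi
        <= K%:E * opnorm (@linf_norm R n) (BH_norm form) Phi)%E.
Proof.
exists 4; split=> // H form n Phi _ Phi_fin Phi1.
set N := opnorm _ _ _ in Phi_fin *.
have zero_le : (0 <= N)%E.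
  apply: (@le_trans _ _ (BH_norm form (Phi 0))).
    apply: le_trans (ereal_sup_ubound _); last by exists 0; [|reflexivity];
      rewrite /= /hilbert_norm linear0l sqrtr0 lee_fin ler01.
    by rewrite lee_fin hilbert_norm_ge0.
  apply: ereal_sup_ubound; exists 0 => //=.
  by rewrite /linf_norm normr0 lee_fin ler01.
(* Boundedness of [Phi] and [zero_le] make [N] finite, so [fine N] is its true value and not a
   default. *)
have NE : (fine N)%:E = N by rewrite fineK// ge0_fin_numE.
have N0 : 0 <= fine N by rewrite -lee_fin NE.
have /boolp.choice[xf xfP] : forall k, exists xf : H * (H -> R[i]),
    {morph xf.2 : u v / u - v} /\
    forall u, Phi (delta_mx 0 k) u = xf.2 u *: xf.1.
  by move=> k; have [x [f xfP]] := rank_oneP (Phi1 k); exists (x, f).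
(* Two nested suprema are unfolded: [Phi a] has norm at most [N], and homogeneity extends this from
   the unit ball to every [u]. *)
have Phi_le a u : (linf_norm a <= 1)%E ->
    hilbert_norm form (Phi a u) <= fine N * hilbert_norm form u.
  move=> a1; apply: (@opnorm_bound _ _ _ (hilbert_norm form)
    (hilbert_norm form) (Phi a)); rewrite ?NE.
  - exact: hilbert_normZ.
  - exact: hilbert_normZ.
  - by move=> ? ?; rewrite linearZ.
  - exact: hilbert_norm_ge0.
  - by apply: ereal_sup_ubound; exists a.
apply: ge_ereal_sup => _ [m _ <-]; apply: ge_ereal_sup => _ [A A1 <-].
apply: ge_ereal_sup => _ [u u1 <-].
have := mxop_bound (fun k => (xfP k).1) (fun k => (xfP k).2) Phi_le u A1 N0.
have -> : (4%:E * N = (4 * fine N)%:E * 1)%E by rewrite mule1 EFinM NE.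
by move=> /le_trans; apply; apply: lee_wpmul2l => //; rewrite lee_fin mulr_ge0.
Qed.
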